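(* Let $n\ge 1$ be an integer and, for each $I\subset\{0,\dots,2n-1\}$ with $|I|=n$, let $\alpha_I:=\operatorname{Re}\bigl(\sum_{k\in I}\omega_k\bigr)$ and $\beta_I:=\operatorname{Im}\bigl(\sum_{k\in I}\omega_k\bigr)$, where $\omega_k=\exp\bigl(\frac{i\pi}{2n}(2k+[n]_2)\bigr)$. Then, for every $z>0$, $$\det(A_n(z)) = z^{n(2n-1)}\cdot\sum_{I\subset\{0,\dots,2n-1\},\ |I|=n} c_I^{(n)}\cosh(\alpha_I z)\cos(\beta_I z),$$ where the matrix $A_n(z)$ and the constants $c_I^{(n)}$ are as defined in the context.
   Context: Notation: $i$ is the imaginary unit and $[n]_2:=n \bmod 2\in\{0,1\}$. For $k=0,\dots,2n-1$ put $\omega_k=\exp\bigl(\frac{i\pi}{2n}(2k+[n]_2)\bigr)\in\mathbb{C}$. The matrix $A_n(z)=\bigl(a^{(n)}_{j,k}(z)\bigr)_{0\le j,k\le 2n-1}$ is the complex $2n\times 2n$ matrix ($j$ the row index, $k$ the column index) with $$a^{(n)}_{j,k}(z)=\begin{cases}\omega_k^j z^j e^{\omega_k z}, & j<n,\\ \omega_k^j z^j, & j\ge n.\end{cases}$$ For $I\subset\{0,\dots,2n-1\}$ with $|I|=n$, let $C:=\{0,\dots,2n-1\}\setminus I$ and $$c_I^{(n)}:=(-1)^{n(n+1)/2}\; i^{[n]_2\cdot n}\;\Biggl(\prod_{k,\ell\in I,\ k<\ell}(\omega_\ell-\omega_k)\Biggr)\Biggl(\prod_{k,\ell\in C,\ k<\ell}(\omega_\ell-\omega_k)\Biggr)\in\mathbb{C}.$$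 (The matrix $A_n(z)$ arises, with $z=\lambda^{-1/(2n)}$ and $\lambda>0$, by imposing the boundary conditions $u(1)=u'(1)=\dots=u^{(n-1)}(1)=0$, $u^{(n)}(0)=\dots=u^{(2n-1)}(0)=0$ on the fundamental system $e^{\omega_k z t}$, $k=0,\dots,2n-1$, of the ODE $\lambda u^{(2n)}+(-1)^{n+1}u=0$.) *)

(* Defs.v *)
From HB Require Import structures.
From mathcomp Require Import all_boot all_order all_algebra.
From mathcomp Require Import complex.
From mathcomp Require Import reals sequences exp trigo.

Set Implicit Arguments.
Unset Strict Implicit.
Unset Printing Implicit Defensive.

Import Order.TTheory GRing.Theory Num.Theory.

Local Open Scope ring_scope.
Local Open Scope complex_scope.

Section Defs.
Variable R : realType.

(* e^(x + iy) = e^x (cos y + i sin y) *)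
Definition cexp (w : R[i]) : R[i] :=
  (expR (complex.Re w))%:C *
  (cos (complex.Im w) +i* sin (complex.Im w)).

Definition cosh (x : R) : R := (expR x + expR (- x)) / 2.

(* The 2n roots of w^(2n) = (-1)^n, counterclockwise. *)
Definition omega (n k : nat) : R[i] :=
  cexp ('i%C * (pi / (2 * n)%:R * (2 * k + n %% 2)%:R)%:C).

(* Boundary conditions on the functions t |-> e^(omega_k z t): derivatives of
   order j < n at t = 1, of order n <= j < 2n at t = 0. *)
Definition Amx (n : nat) (z : R) : 'M[R[i]]_(2 * n) :=
  \matrix_(j < 2 * n, k < 2 * n)
    if (j < n)%N then omega n k ^+ j * z%:C ^+ j * cexp (omega n k * z%:C)
    else omega n k ^+ j * z%:C ^+ j.

Definition omega_diffs (n : nat) (J : {set 'I_(2 * n)}) : R[i] :=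
  \prod_(k in J) \prod_(l in J | (k < l)%N) (omega n l - omega n k).

Definition coef (n : nat) (I : {set 'I_(2 * n)}) : R[i] :=
  (-1) ^+ (n * (n + 1) %/ 2) * 'i%C ^+ (n %% 2 * n)
  * omega_diffs I * omega_diffs (~: I).

Definition alpha (n : nat) (I : {set 'I_(2 * n)}) : R :=
  complex.Re (\sum_(k in I) omega n k).

Definition beta (n : nat) (I : {set 'I_(2 * n)}) : R :=
  complex.Im (\sum_(k in I) omega n k).

End Defs.

(* Main.v *)
Require Import Defs.
From mathcomp Require Import all_boot all_order all_algebra.
From mathcomp Require Import complex.
From mathcomp Require Import reals sequences exp trigo.
From mathcomp Require Import perm zify ring.

Import Order.TTheory GRing.Theory Num.Theory.

Local Open Scope ring_scope.
Local Open Scope complex_scope.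

(** The first n rows of A_n(z) are Vandermonde rows in the nodes omega_k z with
    column k scaled by exp(omega_k z), and the last n rows are the remaining,
    unscaled Vandermonde rows.  Expanding the determinant along this splitting
    of the rows gives one term for every n-element set I of columns given to
    the scaled rows ([det_two_block_Vandermonde]).  That term contains the
    exponential of S_I z, where S_I is the sum of the omega_k over I, and the
    Vandermonde products of I and of its complement C.  The signs of the
    expansion and the factors omega_l ^ n, for l in C, combine into a constant
    that does not depend on I ([sign_coef]); hence det A_n(z) is z^(n(2n-1))
    times the sum of the c_I exp(S_I z) ([det_Amx_cexp]).

    Replacing exp(S_I z) by cosh(alpha_I z) cos(beta_I z), which is the mean of
    exp(w z) over the four numbers w = S_I, - S_I and their conjugates, requires
    that c_I be unchanged when negation or conjugation acts on the index sets.
    Both maps permute the omega_k and preserve distances, so they preserve the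
    modulus of c_I.  The argument of c_I is the same for all I
    ([coef_normE]): with rho = exp(i pi / 2n), so that omega_k is
    rho ^ (2k + n mod 2), each difference omega_l - omega_k with k < l is
    i rho^(n mod 2) rho^k rho^l times the positive number
    2 sin((l - k) pi / 2n), and when these phases are multiplied over the pairs
    inside I and the pairs inside C every index is met exactly n - 1 times. *)

(** * Products over ordered pairs of indices *)

(** Each unordered pair contributes its two orientations at once, so the order
    of the indices disappears; this is how order-dependent products are counted
    and shown invariant below. *)
Lemma big_ordered_pairs (T : Type) (idx : T) (op : Monoid.com_law idx)
    (N : nat) (J : {set 'I_N}) (f : 'I_N -> 'I_N -> T) :
  \big[op/idx]_(k in J) \big[op/idx]_(l in J | (k < l)%N) op (f k l) (f l k) =
  \big[op/idx]_(k in J) \big[op/idx]_(l in J | l != k) f k l.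
Proof.
under eq_bigr => k _ do rewrite big_split.
rewrite big_split /= [X in op _ X](exchange_big_dep (mem J)) /=; last first.
  by move=> k l _ /andP[].
rewrite -big_split /=; apply: eq_bigr => k kJ.
rewrite [RHS](bigID (fun l : 'I_N => (k < l)%N)) /=; congr (op _ _).
  apply: eq_bigl => l; rewrite -andbA; congr (_ && _).
  by rewrite -val_eqE /=; lia.
apply: eq_bigl => l; rewrite kJ -!andbA /=; congr (_ && _).
by rewrite -val_eqE /=; lia.
Qed.

Lemma card_ordered_pairs (N : nat) (J : {set 'I_N}) :
  (\sum_(k in J) \sum_(l in J | (k < l)%N) 1)%N = 'C(#|J|, 2).
Proof.
apply: double_inj.
rewrite -mul2n -[RHS]mul2n mul_bin_left bin1 subn1 big_distrr /=.
under eq_bigr => k _ do rewrite big_distrr /=.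
rewrite (big_ordered_pairs _ _ _ _ _ (fun _ _ => 1%N)) /=.
transitivity (\sum_(k in J) #|J|.-1)%N; last by rewrite sum_nat_const mulnC.
apply: eq_bigr => k kJ; rewrite sum1_card (cardsD1 k J) kJ /=.
by apply: eq_card => l; rewrite !inE andbC.
Qed.

Lemma prod_pairs_split (R : comPzRingType) (N : nat) (I : {set 'I_N})
    (F : 'I_N -> 'I_N -> R) :
  \prod_(k < N) \prod_(l < N | (k < l)%N) F k l =
  (\prod_(k in I) \prod_(l in I | (k < l)%N) F k l) *
  (\prod_(k in ~: I) \prod_(l in ~: I | (k < l)%N) F k l) *
  \prod_(k in I) \prod_(l in ~: I) (if (k < l)%N then F k l else F l k).
Proof.
rewrite (bigID (mem I)) /=.
have split_l (P : pred 'I_N) :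
    \prod_(k < N | P k) \prod_(l < N | (k < l)%N) F k l =
    (\prod_(k | P k) \prod_(l in I | (k < l)%N) F k l) *
    \prod_(k | P k) \prod_(l in ~: I | (k < l)%N) F k l.
  rewrite -big_split /=; apply: eq_bigr => k _; rewrite (bigID (mem I)) /=.
  by congr (_ * _); apply: eq_bigl => l; rewrite ?inE andbC.
rewrite !split_l [in X in _ * (X * _)](exchange_big_dep (mem I)) /=; last first.
  by move=> k l _ /andP[].
have -> : \prod_(k in I) \prod_(l in ~: I)
      (if (k < l)%N then F k l else F l k) =
    (\prod_(k in I) \prod_(l in ~: I | (k < l)%N) F k l) *
    \prod_(k in I)
      \prod_(i < N | (i \notin I) && ((k \in I) && (i < k)%N)) F i k.
  rewrite -big_split /=; apply: eq_bigr => k kI.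
  rewrite (bigID (fun l : 'I_N => (k < l)%N)) /=; congr (_ * _).
    by apply: eq_bigr => l /andP[_ ->].
  apply: eq_big => l; last by move=> /andP[_ /negPf->].
  rewrite !inE kI /=; case: (boolP (l \in I)) => //= lI.
  rewrite -leqNgt leq_eqVlt orb_idl // => /eqP/val_inj e.
  by rewrite e kI in lI.
rewrite -!mulrA; congr (_ * _); rewrite [RHS]mulrCA; congr (_ * _).
rewrite mulrC; congr (_ * _).
by apply: eq_bigl => k; rewrite inE.
Qed.

(** * Laplace expansion of a two-block Vandermonde determinant *)

(** The inversions of the shuffle that lists I before its complement. *)
Definition inv_num {N : nat} (I : {set 'I_N}) : nat :=
  \sum_(k in I) \sum_(l in ~: I) (l < k)%N.

Definition vandermonde_prod {R : pzRingType} {N : nat}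
    (x : 'I_N -> R) (J : {set 'I_N}) : R :=
  \prod_(k in J) \prod_(l in J | (k < l)%N) (x l - x k).

Lemma vandermonde_prodZ (R : comPzRingType) (N : nat)
    (x : 'I_N -> R) (a : R) (J : {set 'I_N}) :
  vandermonde_prod (fun k => a * x k) J =
  a ^+ 'C(#|J|, 2) * vandermonde_prod x J.
Proof.
rewrite -card_ordered_pairs -prodrXr -big_split; apply: eq_bigr => k _ /=.
rewrite -prodrXr -big_split; apply: eq_bigr => l _ /=.
by rewrite expr1 mulrBr.
Qed.

(** Orienting every mixed pair from I to its complement costs a sign for each
    inversion. *)
Lemma det_Vandermonde_split (R : comPzRingType) (N : nat)
    (I : {set 'I_N}) (x : 'I_N -> R) :
  \det (Vandermonde N (\row_k x k)) =
  (-1) ^+ inv_num I * vandermonde_prod x I * vandermonde_prod x (~: I) *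
  \prod_(k in I) \prod_(l in ~: I) (x l - x k).
Proof.
rewrite det_Vandermonde.
have -> : \prod_(k < N) \prod_(l < N | (k < l)%N)
      ((\row_j x j) 0 l - (\row_j x j) 0 k) =
    \prod_(k < N) \prod_(l < N | (k < l)%N) (x l - x k).
  by apply: eq_bigr => k _; apply: eq_bigr => l _; rewrite !mxE.
rewrite (prod_pairs_split _ _ I) -!mulrA [RHS]mulrCA; congr (_ * _).
rewrite [RHS]mulrCA; congr (_ * _).
rewrite -prodrXr -big_split; apply: eq_bigr => k kI /=.
rewrite -prodrXr -big_split; apply: eq_big => l //=; rewrite inE => lI.
case: ltngtP => [_|_|/val_inj e]; rewrite ?mul1r ?expr1 ?mulN1r ?opprB //.
by rewrite -e kI in lI.
Qed.

(** Among the m-element sets of indices, the initial segment alone has the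
    smallest sum. *)
Lemma sum_ord_min (N m : nat) (J : {set 'I_N}) :
  (m <= N)%N -> #|J| = m ->
  (\sum_(j in J) j == 'C(m, 2))%N = (J == [set j : 'I_N | (j < m)%N]).
Proof.
move=> mN cJ; set L := [set j : 'I_N | (j < m)%N].
have sL (F : nat -> nat) : (\sum_(j in L) F j = \sum_(0 <= j < m) F j)%N.
  rewrite big_mkord (big_ord_widen _ F mN).
  by apply: eq_bigl => j; rewrite inE.
have sb (A : {set 'I_N}) (c : nat -> nat) :
    (\sum_(j < N) c j * (j \in A) = \sum_(j in A) c j)%N.
  rewrite [RHS]big_mkcond; apply: eq_bigr => j _.
  by case: (j \in A); rewrite ?muln1 ?muln0.
(* (2j + 1 - 2m) ([j in J] - [j in L]) >= 0 termwise, since 2j + 1 - 2m is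
   negative exactly for j in L; being odd it never vanishes, so equality of
   the sums forces J = L. *)
have key : (\sum_(j < N) ((2 * j + 1) * (j \in L) + 2 * m * (j \in J)) <=
          \sum_(j < N) ((2 * j + 1) * (j \in J) + 2 * m * (j \in L))
         ?= iff [forall (j : 'I_N | true), (j \in J) == (j \in L)])%N.
  apply: leqif_sum => j _; rewrite inE; split; first by case: (j \in J); lia.
  by case: (j \in J); lia.
have cL : #|L| = m.
  by rewrite -sum1_card (sL (fun=> 1%N)) sum_nat_const_nat; lia.
move: key.2; rewrite !big_split /=.
rewrite !(sb _ (fun j => 2 * j + 1)%N) !(sb _ (fun=> 2 * m)%N).
rewrite !big_split /= !sum_nat_const cJ cL (sL id) bin2_sum => e.
have -> : ((\sum_(j in J) j)%N == 'C(m, 2)) =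
    [forall j : 'I_N, (j \in J) == (j \in L)].
  rewrite -[RHS]e; move: (\sum_(j in J) j)%N (binomial m 2) => a b.
  by apply/eqP/eqP => [->|]; lia.
by apply/forallP/eqP => [eJ|-> //]; apply/setP => j; apply/eqP/eJ.
Qed.

Lemma vandermonde_prod_morph (R S : pzRingType) (f : {rmorphism R -> S})
    (N : nat) (x : 'I_N -> R) (y : 'I_N -> S) (J : {set 'I_N}) :
  {in J, forall k, y k = f (x k)} ->
  vandermonde_prod y J = f (vandermonde_prod x J).
Proof.
move=> yx; rewrite rmorph_prod; apply: eq_bigr => k kJ.
rewrite rmorph_prod; apply: eq_bigr => l /andP[lJ _].
by rewrite rmorphB !yx.
Qed.

(** Multiply the nodes x_k with k in I by an indeterminate X in the Vandermonde
    determinant.  The permutation s contributes a monomial in X whose exponent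
    is the sum of the rows that s sends into I; by [sum_ord_min] it equals
    'C(m, 2) exactly when these are the first m rows.  In the product form of
    the determinant the pairs inside I contribute X^'C(m, 2), and the constant
    term of the remaining factor leaves x_l for each mixed pair.  Comparing the
    two coefficients gives the block expansion with its sign, without treating
    the minors separately. *)
Lemma sum_perm_Vandermonde (R : comNzRingType) (N m : nat)
    (x : 'I_N -> R) (I : {set 'I_N}) :
  (m <= N)%N -> #|I| = m ->
  \sum_(s : 'S_N | s @: [set j : 'I_N | (j < m)%N] == I)
     (-1) ^+ s * \prod_j x (s j) ^+ j =
  (-1) ^+ inv_num I * vandermonde_prod x I * vandermonde_prod x (~: I) *
     \prod_(l in ~: I) x l ^+ m.
Proof.
move=> mN cI; set L := [set j : 'I_N | (j < m)%N].
pose y k : {poly R} := 'X^(k \in I) * (x k)%:P.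
have sgnP (d : nat) : (-1) ^+ d = ((-1) ^+ d)%:P :> {poly R}.
  by rewrite rmorph_sign.
transitivity (\det (Vandermonde N (\row_k y k)))`_'C(m, 2).
  rewrite /determinant coef_sum [LHS]big_mkcond; apply: eq_bigr => /= s _.
  rewrite sgnP coefCM.
  have -> : \prod_i Vandermonde N (\row_k y k) i (s i) =
      'X^(\sum_(j in s @^-1: I) j) * (\prod_j x (s j) ^+ j)%:P.
    rewrite rmorph_prod -prodrXr [X in X * _]big_mkcond -big_split /=.
    apply: eq_bigr => j _; rewrite !mxE exprMn -!exprM rmorphXn inE /=.
    by case: (s j \in I); rewrite ?mul0n ?mul1n.
  rewrite coefXnM coefC subn_eq0.
  have cs : #|s @^-1: I| = m by rewrite card_preimset //; exact: perm_inj.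
  have := sum_ord_min _ _ _ mN cs; rewrite -/L => e.
  have -> : (s @: L == I) = (s @^-1: I == L).
    apply/eqP/eqP => [<-|<-].
      by apply/setP => j; rewrite inE mem_imset //; exact: perm_inj.
    apply/setP => j; rewrite -{1}[j](permKV s) mem_imset; last exact: perm_inj.
    by rewrite inE permKV.
  by rewrite -e; case: ltngtP; rewrite ?mulr0.
have -> : \det (Vandermonde N (\row_k y k)) =
    (-1) ^+ inv_num I * vandermonde_prod y I * vandermonde_prod y (~: I) *
    \prod_(k in I) \prod_(l in ~: I) (y l - y k).
  exact: det_Vandermonde_split.
have -> : vandermonde_prod y I = 'X^('C(m, 2)) * (vandermonde_prod x I)%:P.
  rewrite -cI -(vandermonde_prod_morph _ _ polyC _ _ (fun k => (x k)%:P)) //.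
  rewrite -vandermonde_prodZ.
  by apply: (vandermonde_prod_morph _ _ idfun) => k kI; rewrite /y kI.
have -> : vandermonde_prod y (~: I) = (vandermonde_prod x (~: I))%:P.
  apply: (vandermonde_prod_morph _ _ polyC) => k.
  by rewrite inE /y => /negPf->; rewrite mul1r.
rewrite sgnP -!mulrA mulrCA coefXnM ltnn subnn.
rewrite !coefCM -horner_coef0; do 3!congr (_ * _).
rewrite horner_prod.
under eq_bigr => k _ do rewrite horner_prod.
rewrite exchange_big /=; apply: eq_bigr => l; rewrite inE => lI.
rewrite -cI -prodr_const; apply: eq_bigr => k kI.
by rewrite /y kI (negPf lI) !hornerE /= subr0.
Qed.

(** Grouping the permutations by the set I of columns that meet the first m rows
    collects the weights w_k, k in I, into a common factor. *)
Lemma det_two_block_Vandermonde (R : comNzRingType) (N m : nat)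
    (x w : 'I_N -> R) :
  (m <= N)%N ->
  \det (\matrix_(j < N, k < N) if (j < m)%N then x k ^+ j * w k else x k ^+ j) =
  \sum_(I : {set 'I_N} | #|I| == m)
    (-1) ^+ inv_num I * vandermonde_prod x I * vandermonde_prod x (~: I) *
     \prod_(l in ~: I) x l ^+ m * \prod_(k in I) w k.
Proof.
move=> mN; set L := [set j : 'I_N | (j < m)%N].
have cL : #|L| = m.
  rewrite -sum1_card -[RHS]muln1 -[m in RHS]subn0 -sum_nat_const_nat big_mkord.
  by rewrite (big_ord_widen _ (fun=> 1%N) mN); apply: eq_bigl => j; rewrite inE.
rewrite /determinant.
rewrite (partition_big (fun s : 'S_N => s @: L) (fun I => #|I| == m)) /=;
  last by move=> s _; rewrite card_imset ?cL //; exact: perm_inj.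
apply: eq_bigr => I /eqP cI; rewrite -sum_perm_Vandermonde // mulr_suml.
apply: eq_bigr => s /eqP <-; rewrite -mulrA; congr (_ * _).
rewrite big_imset /=; last by move=> i j _ _; exact: perm_inj.
rewrite [X in _ * X]big_mkcond -big_split /=; apply: eq_bigr => j _.
by rewrite mxE inE; case: ifP; rewrite ?mulr1.
Qed.

(** For l outside I, the index l counts the smaller indices in I and outside I,
    while [inv_num] counts the larger ones in I; together they count all of I
    and the smaller indices outside I. *)
Lemma inv_num_add (N : nat) (I : {set 'I_N}) :
  (inv_num I + \sum_(l in ~: I) l = #|I| * #|~: I| + 'C(#|~: I|, 2))%N.
Proof.
rewrite /inv_num exchange_big -big_split /= -card_ordered_pairs.
rewrite [X in (_ + X)%N](exchange_big_dep (mem (~: I))) /=; last first.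
  by move=> k l _ /andP[].
rewrite mulnC -sum_nat_const -big_split; apply: eq_bigr => l lC /=.
have e : (l : nat) = (\sum_(k in I) (k < l) + \sum_(k in ~: I) (k < l))%N.
  transitivity (\sum_(k < N) (k < l))%N.
    rewrite -[LHS]muln1 -[X in (X * _)%N]subn0 -sum_nat_const_nat big_mkord.
    by rewrite (big_ord_widen N (fun=> 1%N)) ?(ltnW (ltn_ord l)) // big_mkcond.
  rewrite (bigID (mem I)) /=; congr (_ + _)%N.
  by apply: eq_bigl => k; rewrite inE.
rewrite [X in (_ + X)%N = _]e addnA; congr (_ + _)%N.
  rewrite -big_split /= -sum1_card; apply: eq_bigr => k kI.
  have : k != l by apply: contraTneq lC => <-; rewrite inE kI.
  by rewrite -val_eqE /=; case: ltngtP.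
rewrite [LHS]big_mkcond [RHS]big_mkcond /=; apply: eq_bigr => k _.
by rewrite lC /=; case: (k \in _); case: (k < l)%N.
Qed.

(** A distance-preserving relabelling may reorder the pairs, which changes the
    Vandermonde product but not its modulus: the square of the modulus is a
    product over all pairs of distinct indices, without reference to order. *)
Lemma normr_vandermonde_prod_imset (R : numDomainType) (N : nat) (x : 'I_N -> R)
    (phi : 'I_N -> 'I_N) (J : {set 'I_N}) :
  injective phi -> (forall k l, `|x (phi l) - x (phi k)| = `|x l - x k|) ->
  `|vandermonde_prod x (phi @: J)| = `|vandermonde_prod x J|.
Proof.
move=> phi_inj phi_isom.
have sqr_norm (A : {set 'I_N}) :
    `|vandermonde_prod x A| ^+ 2 =
    \prod_(k in A) \prod_(l in A | l != k) `|x l - x k|.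
  rewrite -big_ordered_pairs normr_prod -prodrXl; apply: eq_bigr => k _.
  rewrite normr_prod -prodrXl; apply: eq_bigr => l _.
  by rewrite expr2 [X in X * _]distrC mulrC distrC.
apply/eqP; rewrite -(eqrXn2 (_ : 0 < 2)%N) //; apply/eqP; rewrite !sqr_norm.
rewrite big_imset /=; last by move=> k l _ _; apply: phi_inj.
apply: eq_bigr => k _; rewrite big_imset_cond /=; last first.
  by move=> i l _ _; apply: phi_inj.
by apply: eq_big => [l|l _]; rewrite ?inj_eq.
Qed.

(** * The complex exponential *)

Section Cexp.
Variable R : realType.
Implicit Types (u v w : R[i]) (x : R).

Lemma cexpE x y : cexp (x +i* y) = (expR x * cos y) +i* (expR x * sin y).
Proof. by rewrite /cexp /=; simpc. Qed.

Lemma cexpD u v : cexp (u + v) = cexp u * cexp v.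
Proof.
case: u v => [a b] [c d]; simpc; rewrite !cexpE; simpc.
by rewrite expRD cosD sinD; congr (_ +i* _); ring.
Qed.

Lemma cexp0 : cexp (0 : R[i]) = 1.
Proof. by rewrite cexpE expR0 cos0 sin0 mulr1 mulr0. Qed.

Lemma cexp_sum (T : finType) (A : {set T}) (F : T -> R[i]) :
  cexp (\sum_(k in A) F k) = \prod_(k in A) cexp (F k).
Proof. exact: (big_morph _ cexpD cexp0). Qed.

Lemma cexpMn w (m : nat) : cexp (w *+ m) = cexp w ^+ m.
Proof.
by elim: m => [|m IH]; rewrite ?mulr0n ?cexp0 // mulrS exprS cexpD IH.
Qed.

(** Adding conjugates keeps exp(Re w) cos(Im w), and adding opposites then makes
    the exponential a hyperbolic cosine. *)
Lemma cexp_symm w :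
  cexp w + cexp (- w) + cexp (conjc w) + cexp (- conjc w) =
  4 * (cosh (complex.Re w) * cos (complex.Im w))%:C.
Proof.
case: w => a b; rewrite /cosh -[(a +i* b)^*]/(a -i* b).
rewrite -[- (a +i* b)]/(- a -i* b) -[- (a -i* b)]/(- a +i* - - b) opprK.
rewrite !cexpE !cosN !sinN.
rewrite [4](_ : _ = 4%:C); last by rewrite rmorph_nat.
by simpc; congr (_ +i* _); field.
Qed.
End Cexp.

(** * The nodes omega_k *)

(** A primitive 4n-th root of unity: all phases below are powers of it. *)
Definition rho (R : realType) (n : nat) : R[i] :=
  cexp ('i%C * (pi / (2 * n)%:R)%:C).

Section Omega.
Variables (R : realType) (n : nat).
Local Notation rho := (rho R n).
Local Notation omega := (omega R n).

Lemma omegaE k : omega k = rho ^+ (2 * k + n %% 2).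
Proof. by rewrite /omega rmorphM rmorph_nat mulrA mulr_natr cexpMn. Qed.

Lemma rhoX m :
  rho ^+ m = cos (pi / (2 * n)%:R * m%:R) +i* sin (pi / (2 * n)%:R * m%:R).
Proof.
have -> : rho ^+ m = cexp (0 +i* (pi / (2 * n)%:R * m%:R)).
  rewrite -cexpMn; congr cexp; rewrite -mulrnAr mulr_natr -rmorphMn.
  by simpc.
by rewrite cexpE expR0 !mul1r.
Qed.

Lemma normr_rho : `|rho| = 1.
Proof. by rewrite -[rho]expr1 rhoX normc_def /= cos2Dsin2 sqrtr1. Qed.

Lemma conj_rho : rho^* * rho = 1.
Proof.
by rewrite -[rho]expr1 rhoX; simpc; rewrite -!expr2 cos2Dsin2 mulrC subrr.
Qed.

Hypothesis n_gt0 : (0 < n)%N.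

Lemma rhoXn : rho ^+ n = 'i%C.
Proof.
rewrite rhoX natrM invfM mulrA mulfVK ?cos_pihalf ?sin_pihalf //.
by rewrite pnatr_eq0 -lt0n.
Qed.

Lemma rhoX2n : rho ^+ (2 * n) = -1.
Proof. by rewrite mulnC exprM rhoXn sqr_i. Qed.

Lemma omega_mod k : omega (k %% (2 * n)) = omega k.
Proof.
rewrite [in RHS](divn_eq k (2 * n)) !omegaE mulnDr -addnA.
have -> : (2 * (k %/ (2 * n) * (2 * n)) = 2 * n * 2 * (k %/ (2 * n)))%N by ring.
rewrite [RHS]exprD (exprM _ (2 * n * 2)%N) (exprM _ (2 * n)%N) rhoX2n.
by rewrite sqrrN !expr1n mul1r.
Qed.

Lemma omega_opp k : omega (k + n) = - omega k.
Proof. by rewrite !omegaE mulnDr addnAC exprD rhoX2n mulrN1. Qed.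

Lemma omega_conj k : (k + n %% 2 <= 2 * n)%N ->
  omega (2 * n - (k + n %% 2)) = (omega k)^*.
Proof.
move=> le_k; rewrite -[LHS]mul1r -[1](expr1n _ (2 * k + n %% 2)) -conj_rho.
rewrite exprMn -mulrA !omegaE -exprD rmorphXn.
have -> : (2 * k + n %% 2 + (2 * (2 * n - (k + n %% 2)) + n %% 2) =
    (2 * n) * 2)%N by lia.
by rewrite exprM rhoX2n sqrrN expr1n mulr1.
Qed.

Lemma omegaXn k : omega k ^+ n = (-1) ^+ k * 'i%C ^+ (n %% 2).
Proof. by rewrite omegaE exprAC rhoXn exprD exprM sqr_i. Qed.

(** Factoring out the midpoint direction rho^(k + l + n mod 2) leaves
    rho^(l - k) minus its conjugate, a sine up to the factor 2i. *)
Lemma omega_diff_sin k l : (k < l)%N ->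
  omega l - omega k = 'i%C * rho ^+ (n %% 2) * (rho ^+ k * rho ^+ l) *
    (2 * sin (pi / (2 * n)%:R * (l - k)%:R))%:C.
Proof.
move=> kl; have rho_sub d :
    rho ^+ d - (rho^* ) ^+ d = 2 * 'i%C * (sin (pi / (2 * n)%:R * d%:R))%:C.
  rewrite -rmorphXn /= rhoX -(rmorph_nat (real_complex R)).
  by simpc; congr (_ +i* _); ring.
rewrite rmorphM rmorph_nat.
rewrite [RHS](_ : _ = rho ^+ (n %% 2) * (rho ^+ k * rho ^+ l) *
  (rho ^+ (l - k) - (rho^* ) ^+ (l - k))); last by rewrite rho_sub; ring.
rewrite mulrBr !omegaE; congr (_ - _).
  by rewrite -!exprD; congr (_ ^+ _); lia.
have el : rho ^+ l = rho ^+ k * rho ^+ (l - k) by rewrite -exprD subnKC // ltnW.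
have e1 : rho ^+ (l - k) * rho^* ^+ (l - k) = 1.
  by rewrite -[LHS]exprMn [rho * _]mulrC conj_rho expr1n.
rewrite el mulrA -[RHS]mulrA -[_ * _ * rho^* ^+ _]mulrA e1 mulr1 -!exprD.
by congr (_ ^+ _); lia.
Qed.

Lemma sin_half_gap_gt0 d : (0 < d < 2 * n)%N ->
  0 < sin (pi / (2 * n)%:R * d%:R) :> R.
Proof.
move=> /andP[d_gt0 d2n].
have n2_gt0 : 0 < (2 * n)%:R :> R by rewrite ltr0n; lia.
apply: sin_gt0_pi; rewrite mulr_gt0 ?divr_gt0 ?pi_gt0 ?(ltr0n _ d) //=.
by rewrite mulrAC ltr_pdivrMr // ltr_pM2l ?pi_gt0 // ltr_nat.
Qed.

Lemma omega_diff_arg k l : (k < l < 2 * n)%N ->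
  omega l - omega k =
  'i%C * rho ^+ (n %% 2) * (rho ^+ k * rho ^+ l) * `|omega l - omega k|.
Proof.
move=> /andP[kl l2n]; have s_gt0 : 0 < sin (pi / (2 * n)%:R * (l - k)%:R) :> R.
  by apply: sin_half_gap_gt0; lia.
rewrite omega_diff_sin //; congr (_ * _).
rewrite !normrM !normrX normr_rho !expr1n !mulr1.
rewrite !normc_def /= !expr0n /= expr1n add0r addr0 sqrtr1 mul1r sqrtr_sqr.
by rewrite gtr0_norm ?mulr_gt0.
Qed.

Lemma omega_inj (k l : 'I_(2 * n)) : omega k = omega l -> k = l.
Proof.
have neq (i j : 'I_(2 * n)) : (i < j)%N -> omega i <> omega j.
  move=> ij /esym/eqP; rewrite -subr_eq0 omega_diff_sin //; apply/negP.
  have rho_neq0 : rho != 0 by rewrite -normr_eq0 normr_rho oner_eq0.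
  have i_neq0 : 'i%C != 0 :> R[i] by rewrite eq_complex /= oner_eq0 andbF.
  rewrite !mulf_neq0 ?expf_neq0 // fmorph_eq0 mulf_neq0 ?pnatr_eq0 //.
  by rewrite gt_eqF // sin_half_gap_gt0 //; have := ltn_ord j; lia.
case: (ltngtP k l) => [/neq //|/neq ne e|/val_inj //]; by case: ne.
Qed.

(** An injective additive map that sends omega_k to omega_(g k) permutes the
    nodes; g may leave the range of the indices because omega_k has period 2n
    in k. *)
Lemma omega_perm (f : {additive R[i] -> R[i]}) (g : nat -> nat) : injective f ->
  (forall k, (k < 2 * n)%N -> omega (g k) = f (omega k)) ->
  exists2 phi : 'I_(2 * n) -> 'I_(2 * n),
    injective phi & forall k, omega (phi k) = f (omega k).
Proof.
move=> f_inj fg; have n2_gt0 : (0 < 2 * n)%N by lia.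
exists (fun k => Ordinal (ltn_pmod (g k) n2_gt0)) => [k l|k]; last first.
  by rewrite /= omega_mod fg.
move=> /(congr1 (fun i : 'I_(2 * n) => omega i)).
by rewrite /= !omega_mod !fg // => /f_inj/omega_inj.
Qed.

Local Notation om := (fun k : 'I_(2 * n) => omega k).

Lemma omega_diffsE (J : {set 'I_(2 * n)}) :
  omega_diffs R J = vandermonde_prod om J.
Proof. by []. Qed.

(** Each index k of J lies in #|J| - 1 pairs, hence contributes its phase rho^k
    that many times. *)
Lemma omega_diffs_arg (J : {set 'I_(2 * n)}) :
  omega_diffs R J = ('i%C * rho ^+ (n %% 2)) ^+ 'C(#|J|, 2) *
    (\prod_(k in J) rho ^+ k) ^+ #|J|.-1 * `|omega_diffs R J|.
Proof.
have -> : (\prod_(k in J) rho ^+ k) ^+ #|J|.-1 =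
    \prod_(k in J) \prod_(l in J | (k < l)%N) (rho ^+ k * rho ^+ l).
  rewrite (big_ordered_pairs _ _ _ _ _ (fun k _ => rho ^+ k)) -prodrXl.
  apply: eq_bigr => k kJ; rewrite (cardsD1 k J) kJ /= -prodr_const.
  by apply: eq_bigl => l; rewrite !inE andbC.
rewrite -card_ordered_pairs -prodrXr normr_prod -!big_split.
apply: eq_bigr => k _ /=.
rewrite -prodrXr normr_prod -!big_split; apply: eq_bigr => l /= /andP[_ kl].
by rewrite expr1 {1}omega_diff_arg // kl ltn_ord.
Qed.

(** * Symmetries of the coefficients *)

(** Since I and its complement have the same cardinal, the phases of their
    indices are raised to the same power, and the product of all of them does
    not depend on I: the coefficients differ only by their moduli. *)
Lemma coef_normE (I : {set 'I_(2 * n)}) : #|I| = n ->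
  coef R I = (-1) ^+ (n * (n + 1) %/ 2) * 'i%C ^+ (n %% 2 * n) *
    ('i%C * rho ^+ (n %% 2)) ^+ ('C(n, 2) * 2) *
    (\prod_(k < 2 * n) rho ^+ k) ^+ n.-1 *
    (`|omega_diffs R I| * `|omega_diffs R (~: I)|).
Proof.
move=> cI; have cC : #|~: I| = n by rewrite cardsCs setCK card_ord cI; lia.
rewrite /coef {1}omega_diffs_arg {1}(omega_diffs_arg (~: I)) cI cC.
have -> : \prod_(k < 2 * n) rho ^+ k =
    (\prod_(k in I) rho ^+ k) * \prod_(k in ~: I) rho ^+ k.
  rewrite (bigID (mem I)) /=; congr (_ * _).
  by apply: eq_bigl => k; rewrite inE.
rewrite [(_ * \prod_(k in ~: I) _) ^+ _]exprMn [_ ^+ ('C(n, 2) * 2)]exprM.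
have rearrange (a c d e f g : R[i]) :
  a * (c * d * f) * (c * e * g) = a * c ^+ 2 * (d * e) * (f * g) by ring.
exact: rearrange.
Qed.

Lemma coef_imset (phi : 'I_(2 * n) -> 'I_(2 * n)) (I : {set 'I_(2 * n)}) :
  injective phi ->
  (forall k l : 'I_(2 * n),
     `|omega (phi l) - omega (phi k)| = `|omega l - omega k|) ->
  #|I| = n -> coef R (phi @: I) = coef R I.
Proof.
move=> phi_inj phi_isom cI; rewrite (coef_normE _ cI) coef_normE; last first.
  by rewrite (card_imset _ phi_inj) cI.
have -> : ~: (phi @: I) = phi @: (~: I).
  apply/esym/setP/subset_cardP.
    by rewrite [RHS]cardsCs setCK !(card_imset _ phi_inj) [LHS]cardsCs setCK.
  apply/subsetP => _ /imsetP[k kI ->]; rewrite !inE mem_imset //.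
  by rewrite inE in kI.
have norm_imset (J : {set 'I_(2 * n)}) :
    `|@omega_diffs R n (phi @: J)| = `|@omega_diffs R n J| :> R[i].
  exact: (normr_vandermonde_prod_imset _ _ om _ _ phi_inj phi_isom).
by rewrite !norm_imset.
Qed.

(** An isometry that permutes the nodes permutes the n-element sets I without
    changing the coefficients, so it may be applied to all node sums at once. *)
Lemma sum_coef_isom (f : {additive R[i] -> R[i]}) (g : nat -> nat)
    (F : R[i] -> R[i]) :
  (forall u, `|f u| = `|u|) ->
  (forall k, (k < 2 * n)%N -> omega (g k) = f (omega k)) ->
  \sum_(I : {set 'I_(2 * n)} | #|I| == n)
     coef R I * F (f (\sum_(k in I) omega k)) =
  \sum_(I : {set 'I_(2 * n)} | #|I| == n)
     coef R I * F (\sum_(k in I) omega k).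
Proof.
move=> f_isom fg.
have f_inj : injective f.
  move=> u v /eqP; rewrite -subr_eq0 -raddfB -normr_eq0 f_isom normr_eq0.
  by rewrite subr_eq0 => /eqP.
have [phi phi_inj phiE] := omega_perm f g f_inj fg.
rewrite [RHS](reindex_inj (imset_inj phi_inj)) /=.
apply: eq_big => [I|I /eqP cI]; first by rewrite (card_imset _ phi_inj).
rewrite coef_imset // => [|k l]; last by rewrite !phiE -raddfB f_isom.
rewrite big_imset /=; last by move=> k l _ _; apply: phi_inj.
by rewrite raddf_sum; under [in RHS]eq_bigr => k _ do rewrite phiE.
Qed.

Lemma sum_coef_opp (F : R[i] -> R[i]) :
  \sum_(I : {set 'I_(2 * n)} | #|I| == n)
     coef R I * F (- \sum_(k in I) omega k) =
  \sum_(I : {set 'I_(2 * n)} | #|I| == n)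
     coef R I * F (\sum_(k in I) omega k).
Proof.
apply: (sum_coef_isom (-%R) (fun k => k + n)%N) => [u|k _]; first exact: normrN.
exact: omega_opp.
Qed.

Lemma sum_coef_conj (F : R[i] -> R[i]) :
  \sum_(I : {set 'I_(2 * n)} | #|I| == n)
     coef R I * F (conjc (\sum_(k in I) omega k)) =
  \sum_(I : {set 'I_(2 * n)} | #|I| == n)
     coef R I * F (\sum_(k in I) omega k).
Proof.
apply: (sum_coef_isom conjc (fun k => 2 * n - (k + n %% 2))%N) => [u|k k2n].
  by case: u => a b; rewrite !normc_def /= sqrrN.
by apply: omega_conj; lia.
Qed.

(** * The determinant *)

(** As omega_l ^ n = (-1)^l i^(n mod 2), the sign has exponent [inv_num] plus
    the sum of the complement of I, which is independent of I by
    [inv_num_add]. *)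
Lemma sign_coef (I : {set 'I_(2 * n)}) : #|I| = n ->
  (-1) ^+ inv_num I * \prod_(l in ~: I) omega l ^+ n =
  (-1) ^+ (n * (n + 1) %/ 2) * 'i%C ^+ (n %% 2 * n).
Proof.
move=> cI; have cC : #|~: I| = n by rewrite cardsCs setCK card_ord cI; lia.
under eq_bigr => l _ do rewrite omegaXn.
rewrite big_split /= prodrXr prodr_const cC -exprM mulrA -exprD.
rewrite inv_num_add cI cC.
congr (_ * _); rewrite -signr_odd -[RHS]signr_odd; congr (_ ^+ _).
have -> : (n * (n + 1) %/ 2 = 'C(n, 2) + n)%N.
  have e : (n * (n + 1) = ('C(n, 2) + n) * 2)%N.
    by have := mul_bin_left n 1; rewrite bin1; nia.
  by rewrite e mulnK.
by rewrite !oddD oddM andbb addbC.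
Qed.

Lemma det_Amx_cexp (z : R) :
  \det (Amx n z) = z%:C ^+ (n * (2 * n - 1)) *
    \sum_(I : {set 'I_(2 * n)} | #|I| == n)
       coef R I * cexp ((\sum_(k in I) omega k) * z%:C).
Proof.
have -> : Amx n z = \matrix_(j < 2 * n, k < 2 * n)
    if (j < n)%N then (z%:C * omega k) ^+ j * cexp (omega k * z%:C)
    else (z%:C * omega k) ^+ j.
  by apply/matrixP => j k; rewrite !mxE [z%:C * _]mulrC [(_ * z%:C) ^+ _]exprMn.
rewrite (det_two_block_Vandermonde _ _ _ (fun k => z%:C * omega k)
  (fun k => cexp (omega k * z%:C))); last by lia.
rewrite big_distrr; apply: eq_bigr => I /eqP cI /=.
have cC : #|~: I| = n by rewrite cardsCs setCK card_ord cI; lia.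
rewrite !(vandermonde_prodZ _ _ om) mulr_suml cexp_sum mulrA; congr (_ * _).
rewrite cI cC -!omega_diffsE /coef -(sign_coef I cI).
under eq_bigr => l _ do rewrite exprMn.
rewrite big_split /= prodr_const cC -exprM.
have -> : (n * (2 * n - 1) = 'C(n, 2) + 'C(n, 2) + n * n)%N.
  by have := mul_bin_left n 1; rewrite bin1; nia.
rewrite !exprD; ring.
Qed.

End Omega.

Theorem theorem1 (R : realType) (n : nat) (hn : (1 <= n)%N)
    (z : R) (hz : 0 < z) :
  \det (Amx n z) =
    z%:C ^+ (n * (2 * n - 1)) *
    \sum_(I : {set 'I_(2 * n)} | #|I| == n)
       coef R I * (cosh (alpha R I * z) * cos (beta R I * z))%:C.
Proof.
rewrite det_Amx_cexp //; congr (_ * _).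
pose F (w : R[i]) : R[i] := cexp (w * z%:C).
apply: (@mulfI _ (4 : R[i])); first by rewrite pnatr_eq0.
set S := \sum_(I | _) _.
have So : _ = S := sum_coef_opp _ _ hn F.
have Sc : _ = S := sum_coef_conj _ _ hn F.
have Soc : _ = S := etrans (sum_coef_opp _ _ hn (fun w => F (conjc w))) Sc.
have -> : 4 * S = S + S + S + S by ring.
(* The four copies of S are evaluated at w, - w and their conjugates, for the
   node sums w = S_I. *)
rewrite -{2}So -{2}Sc -{2}Soc -!big_split [RHS]mulr_sumr.
apply: eq_bigr => I _ /=.
rewrite [RHS]mulrCA -!mulrDr; congr (_ * _).
set w := \sum_(k in I) _; rewrite /F -/w.
have <- : complex.Re (w * z%:C) = alpha R I * z.
  by rewrite /alpha -/w; case: w => a b; simpc.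
have <- : complex.Im (w * z%:C) = beta R I * z.
  by rewrite /beta -/w; case: w => a b; simpc.
have conj_wz : conjc (w * z%:C) = conjc w * z%:C.
  by case: w => a b; simpc.
by rewrite -cexp_symm conj_wz raddfN !mulNr.
Qed.
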